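(* Let $\pi$ be a permutation of size $n$ with $k$ descents, let $\mathcal V(\pi)\subseteq\mathbb Z_{>0}^{k+1}$ be its set of valid compositions, and let $\mathrm{Fer}_\pi=\mathrm{conv}(\mathcal V(\pi))\subseteq\mathbb R^{k+1}$ be its fertilitope. Then \[\mathcal V(\pi)=\mathrm{Fer}_\pi\cap\mathbb Z^{k+1}.\]
   Context: A permutation of size $n\ge 1$ is an ordering $\pi=\pi_1\cdots\pi_n$ of a set of $n$ distinct positive integers. A descent of $\pi$ is an index $i\in[n-1]$ with $\pi_i>\pi_{i+1}$. The plot of $\pi$ is the set of points $(i,\pi_i)$, $i\in[n]$. A hook of $\pi$ with southwest endpoint $(i,\pi_i)$ and northeast endpoint $(j,\pi_j)$, where $i<j$ and $\pi_i<\pi_j$, is the union of the vertical segment from $(i,\pi_i)$ to $(i,\pi_j)$ and the horizontal segment from $(i,\pi_j)$ to $(j,\pi_j)$. A point $(m,\pi_m)$ lies directly above (respectively, below) this hook if $i<m<j$ and $\pi_m>\pi_j$ (respectively, $\pi_m<\pi_j$). Let $d_1<\cdots<d_k$ be the descents of $\pi$. A valid hook configuration of $\pi$ is a tuple $\mathcal H=(H_1,\ldots,H_k)$ of hooks of $\pi$ such that: (1) $H_i$ has southwest endpoint $(d_i,\pi_{d_i})$ for each $i$; (2) no point of the plot lies directly above a hook of $\mathcal H$; (3) no two hooks of $\mathcal H$ intersect or overlap, except that the northeast endpoint of one may be the southwest endpoint of another. (If $k=0$, there is exactly one, the empty configuration.) Let $\mathrm{VHC}(\pi)$ be the set of valid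 hook configurations of $\pi$. Each $\mathcal H\in\mathrm{VHC}(\pi)$ induces a coloring of the $n-k$ points of the plot that are not northeast endpoints of hooks of $\mathcal H$: such a point $(m,\pi_m)$ gets the color of the lowest hook of $\mathcal H$ lying above it (i.e. among the hooks of $\mathcal H$ below which it lies, the one whose northeast endpoint has smallest height; a hook is not considered to lie above its own southwest endpoint), and the color of the ''sky'' if there is no such hook. Let $q_i$ be the number of points with the color of $H_i$ ($1\le i\le k$) and $q_0$ the number with the color of the sky. Then $\mathbf q^{\mathcal H}=(q_0,\ldots,q_k)$ is a composition of $n-k$ into $k+1$ (positive) parts. Set $\mathcal V(\pi)=\{\mathbf q^{\mathcal H}:\mathcal H\in\mathrm{VHC}(\pi)\}$, the set of valid compositions of $\pi$; it may be empty. $\mathrm{conv}$ denotes convex hull. *)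

(* Defs.v *)
From mathcomp Require Import all_boot all_order all_algebra.
From mathcomp Require Import classical_sets reals convex.

Set Implicit Arguments.
Unset Strict Implicit.
Unset Printing Implicit Defensive.

Import Order.TTheory GRing.Theory Num.Theory.

Local Open Scope classical_set_scope.
Local Open Scope ring_scope.

(* A permutation of size n is given by its word p : n.-tuple nat.  Positions
   are numbered from 0, so that the entry pi_i of the mathematical text is
   tnth p (i - 1). *)

Definition descents (n : nat) (p : n.-tuple nat) : seq nat :=
  [seq i <- iota 0 n.-1 | (nth 0 p i > nth 0 p i.+1)%N].

Definition ndes (n : nat) (p : n.-tuple nat) : nat := size (descents p).

Record hook (n : nat) (p : n.-tuple nat) := Hook {
  sw : 'I_n;
  ne : 'I_n;
  sw_ltn_ne : (sw < ne)%N;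
  hook_rises : (tnth p sw < tnth p ne)%N
}.

Definition plot_point (R : realType) (n : nat) (p : n.-tuple nat) (i : 'I_n) :
    R * R :=
  (i.+1%:R, (tnth p i)%:R).

Definition hook_points (R : realType) (n : nat) (p : n.-tuple nat)
    (h : hook p) : set (R * R) :=
  let: (x1, y1) := plot_point R p (sw h) in
  let: (x2, y2) := plot_point R p (ne h) in
  [set z | z.1 = x1 /\ y1 <= z.2 <= y2] `|`
  [set z | x1 <= z.1 <= x2 /\ z.2 = y2].
Arguments hook_points R {n p} h _.

Definition directly_above (n : nat) (p : n.-tuple nat) (h : hook p)
    (m : 'I_n) : bool :=
  [&& sw h < m, m < ne h & tnth p m > tnth p (ne h)]%N.

Definition directly_below (n : nat) (p : n.-tuple nat) (h : hook p)
    (m : 'I_n) : bool :=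
  [&& sw h < m, m < ne h & tnth p m < tnth p (ne h)]%N.

Definition is_vhc (R : realType) (n : nat) (p : n.-tuple nat)
    (H : 'I_(ndes p) -> hook p) : Prop :=
  [/\ forall a, sw (H a) = nth 0%N (descents p) a :> nat,
      forall a m, ~~ directly_above (H a) m
    & forall a b, a != b -> forall z,
        hook_points R (H a) z -> hook_points R (H b) z ->
        (z = plot_point R p (ne (H a)) /\ z = plot_point R p (sw (H b))) \/
        (z = plot_point R p (ne (H b)) /\ z = plot_point R p (sw (H a)))].

Definition lowest_hook_above (n k : nat) (p : n.-tuple nat)
    (H : 'I_k -> hook p) (m : 'I_n) (a : 'I_k) : bool :=
  directly_below (H a) m &&
  [forall b, directly_below (H b) m ==>
     (tnth p (ne (H a)) <= tnth p (ne (H b)))%N].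

(* None is the color of the sky.  In a valid hook configuration the northeast
   endpoints of the hooks are distinct, so the lowest hook is unique. *)
Definition color (n k : nat) (p : n.-tuple nat) (H : 'I_k -> hook p)
    (m : 'I_n) : option 'I_k :=
  [pick a | lowest_hook_above H m a].

Definition is_ne_endpoint (n k : nat) (p : n.-tuple nat)
    (H : 'I_k -> hook p) (m : 'I_n) : bool :=
  [exists a, m == ne (H a)].

(* unlift ord0 sends index 0 to None (the sky), and index a + 1 to Some a (the
   hooks being numbered from 0). *)
Definition color_composition (n k : nat) (p : n.-tuple nat)
    (H : 'I_k -> hook p) : 'rV[int]_k.+1 :=
  \row_(j < k.+1)
     #|[pred m : 'I_n | ~~ is_ne_endpoint H m & color H m == unlift ord0 j]|%:Z.

Definition valid_compositions (R : realType) (n : nat) (p : n.-tuple nat) :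
    set 'rV[int]_(ndes p).+1 :=
  [set q | exists2 H : 'I_(ndes p) -> hook p,
             is_vhc R H & q = color_composition H].
Arguments valid_compositions R {n} p _.

Definition int_embedding (R : realType) (m : nat) (q : 'rV[int]_m) : 'rV[R]_m :=
  map_mx intr q.
Arguments int_embedding R {m} q.

Definition convex_hull (R : realType) (m : nat) (A : set 'rV[R]_m) :
    set 'rV[R]_m :=
  smallest (@convex_set R 'rV[R]_m) A.

Definition fertilitope (R : realType) (n : nat) (p : n.-tuple nat) :
    set 'rV[R]_(ndes p).+1 :=
  convex_hull (int_embedding R @` valid_compositions R p).
Arguments fertilitope R {n} p _.

(* Main.v *)
Require Import Defs.
From mathcomp Require Import all_boot all_order all_algebra zify.
From mathcomp Require Import classical_sets reals convex.
From mathcomp Require Import interval_inference.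

(* The set of valid compositions is the set of all integer points of a
   polyhedron, hence of its own convex hull.  To see this, let m be the largest
   descent top, and write the word as A m B T where T is the increasing run of
   the entries exceeding m that ends the word.  The hook at m must end at some
   entry t of T = T1 t T2, and then the other hooks form independent valid
   configurations of the words A m T2 and B T1; the composition is the
   concatenation of the compositions of these two words.  By induction, the
   compositions of A m T2 (respectively B T1) are cut out by lower bounds on
   partial sums that do not involve the tail, together with the value of the
   total sum, which depends only on the length of the tail.  Letting t run over
   T replaces the two total sums by their common value and one lower bound for
   each factor. *)

Set Implicit Arguments.
Unset Strict Implicit.
Unset Printing Implicit Defensive.

Import Order.TTheory GRing.Theory Num.Theory.

(** * Hook configurations of words *)

(** Entries being distinct, a descent is identified with the entry at its top. The default [x] of
    [head] keeps the last entry from counting. *)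
Fixpoint descent_tops (w : seq nat) : seq nat :=
  if w is x :: w' then
    if head x w' < x then x :: descent_tops w' else descent_tops w'
  else [::].

(** Comparing positions suffices: when no point lies above the hook of [u], the points strictly
    between its endpoints lie directly below it. *)
Definition sheltered (w : seq nat) (J : nat -> nat) (u v : nat) : bool :=
  index u w < index v w < index (J u) w.

(* Points are identified with their heights: [J] sends the southwest endpoint
   of a hook to its northeast endpoint.  For hooks with no point above, two of
   them meet exactly when the intervals of positions they span cross. *)
Definition hook_configuration (w : seq nat) (J : nat -> nat) : Prop :=
  forall u, u \in descent_tops w ->
  [/\ J u \in w, index u w < index (J u) w,
      forall v, v \in w -> index u w <= index v w < index (J u) w -> v < J u
    & forall v, v \in descent_tops w -> sheltered w J u v ->
        index (J v) w < index (J u) w].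

Definition skyward (w : seq nat) (J : nat -> nat) (v : nat) : bool :=
  ~~ has (sheltered w J ^~ v) (descent_tops w).

Definition lowest_over (w : seq nat) (J : nat -> nat) (u v : nat) : bool :=
  sheltered w J u v &&
  all (fun u' => sheltered w J u' v ==> (J u <= J u')) (descent_tops w).

Definition num_points (w : seq nat) (J : nat -> nat) (c : pred nat) : nat :=
  count (fun v => (v \notin map J (descent_tops w)) && c v) w.

Definition composition_of (w : seq nat) (J : nat -> nat) : seq nat :=
  num_points w J (skyward w J) ::
  [seq num_points w J (lowest_over w J u) | u <- descent_tops w].

Definition valid_composition (w q : seq nat) : Prop :=
  exists2 J, hook_configuration w J & q = composition_of w J.

(** Appending such a [t] creates no descent, so [w] and [w ++ t] have the same southwest endpoints
    of hooks. *)
Definition tail_of (w t : seq nat) : bool := sorted ltn t && allrel ltn w t.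

Lemma descent_tops_subseq w : subseq (descent_tops w) w.
Proof.
elim: w => // x w IH; rewrite [descent_tops _]/=; case: ifP => _.
  by rewrite /= eqxx.
exact: subseq_trans IH (subseq_cons _ _).
Qed.

Lemma descent_tops_sub w : {subset descent_tops w <= w}.
Proof. exact: mem_subseq (descent_tops_subseq w). Qed.

Lemma descent_tops_sorted w : sorted ltn w -> descent_tops w = [::].
Proof.
elim: w => // x [|y w] IH /=; first by rewrite ltnn.
by case/andP=> xy /IH /= ->; rewrite ltnNge ltnW.
Qed.

Lemma descent_tops_cat s1 s2 : s2 != [::] -> all (ltn^~ (head 0 s2)) s1 ->
  descent_tops (s1 ++ s2) = descent_tops s1 ++ descent_tops s2.
Proof.
case: s2 => // y s2 _ /=; elim: s1 => //= x s1 IH /andP[xy sy].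
rewrite IH //; case: s1 sy {IH} => [|z s1] //= _.
  by rewrite ltnn ltnNge ltnW.
by case: ifP.
Qed.

Lemma descent_tops_tail w t : tail_of w t ->
  descent_tops (w ++ t) = descent_tops w.
Proof.
case: t => [|y t]; first by rewrite cats0.
case/andP=> st wt; rewrite descent_tops_cat //=.
  by rewrite [X in _ ++ X](descent_tops_sorted st) cats0.
by move: wt; rewrite allrel_consr => /andP[].
Qed.

(** * Positions in subwords and blocks *)

(** Hook configurations see positions only through comparisons, and both factors of the
    decomposition are subwords of [w]; this carries the conditions from one word to the other. *)
Lemma index_subseq_lt (s w : seq nat) (x y : nat) : subseq s w -> uniq w ->
  x \in s -> y \in s -> (index x s < index y s) = (index x w < index y w).
Proof.
elim: w s => [|a w IH] [|b s] //.
have ic z s' : index z (a :: s') = if a == z then 0 else (index z s').+1 by [].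
rewrite [subseq _ _]/= cons_uniq.
case: eqP => [->{b} sw /andP[aw uw]|_ sw /andP[aw uw] xs ys].
  rewrite !inE !ic ![a == _]eq_sym.
  case: eqP => [->|_] /=; case: eqP => [->|_] //= xs ys.
  by rewrite !ltnS IH.
have nas z : z \in b :: s -> (a == z) = false.
  by move=> zs; apply: contraNF aw => /eqP ->; apply: (mem_subseq sw).
by rewrite !ic !nas // ltnS IH.
Qed.

(* [index_mem] and [index_cat] with sizes stated at [nat] rather than at its
   [eqType] instance; [lia] does not identify the two. *)
Lemma mem_indexE (v : nat) (s : seq nat) : (v \in s) = (index v s < size s).
Proof. by rewrite index_mem. Qed.

Lemma index_catE (v : nat) (s1 s2 : seq nat) : index v (s1 ++ s2) =
  if v \in s1 then index v s1 else size s1 + index v s2.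
Proof. exact: index_cat. Qed.

Lemma mem_index_block (v : nat) (s1 s2 s3 : seq nat) : uniq (s1 ++ s2 ++ s3) ->
  (v \in s2) =
  (size s1 <= index v (s1 ++ s2 ++ s3) < size s1 + size s2).
Proof.
rewrite cat_uniq => /and3P[_ /hasPn h _]; rewrite !index_catE.
case: ifP => v1.
  rewrite [RHS](_ : _ = false); last by rewrite mem_indexE in v1; lia.
  by apply: contraTF v1 => v2; apply: h; rewrite mem_cat v2.
by rewrite mem_indexE; case: ifP; lia.
Qed.

(** This is why a hook ending in the tail never has a point above it. *)
Lemma ltn_tail (w t : seq nat) (x y : nat) : uniq (w ++ t) -> tail_of w t ->
  x \in w ++ t -> y \in t -> index x (w ++ t) < index y (w ++ t) -> x < y.
Proof.
move=> u /andP[st wt] xwt yt.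
have yw : y \notin w.
  by move: u; rewrite cat_uniq => /and3P[_ /hasPn/(_ _ yt) ? _].
rewrite !index_cat (negPf yw); case: ifP => xw.
  by move=> _; move/allrelP: wt; apply.
rewrite ltn_add2l => lt; have := sorted_ltn_nth ltn_trans 0 st.
move/(_ (index x t) (index y t)); rewrite !inE !index_mem !nth_index //.
  by apply=> //; move: xwt; rewrite mem_cat xw.
by move: xwt; rewrite mem_cat xw.
Qed.

(** The induction appends a last entry [x]. If [T] is empty, [x] joins [B] or starts [T] according
    to its comparison with [m]; otherwise it is compared with the last entry of [T]. *)
Lemma descent_split (w : seq nat) : uniq w -> sorted ltn w \/
  exists (A : seq nat) (m : nat) (B T : seq nat), [/\
    w = A ++ m :: B ++ T, B != [::],
    all (ltn^~ m) A, all (ltn^~ m) B & tail_of (A ++ m :: B) T].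
Proof.
elim/last_ind: w => [|w x IH]; first by left.
rewrite rcons_uniq => /andP[xw uw].
case: (IH uw) => [sw|[A [m [B [T [E B0 Am Bm /andP[sT aT]]]]]]].
  case/lastP: w sw xw {IH uw} => [|w y] sw xw; first by left.
  have yx : y != x by apply: contraNneq xw => ->; rewrite mem_rcons mem_head.
  case: (ltnP y x) => [ltyx|lexy].
    left; rewrite -!cats1 -catA /= sorted_cat_cons /= sw /=.
    by rewrite ltyx.
  right; exists w, y, [:: x], [::]; split => //=.
  - by rewrite -!cats1 -catA.
  - move: sw; rewrite -cats1 sorted_pairwise; last exact: ltn_trans.
    rewrite pairwise_cat allrel_consr => /and3P[/andP[]] //.
  - by rewrite ltn_neqAle eq_sym yx lexy.
  by rewrite /tail_of /= allrel0r.
right.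
case/lastP: T E sT aT => [|T t] E sT aT.
  rewrite cats0 in E.
  have xm : x != m by apply: contraNneq xw => ->; rewrite E mem_cat mem_head orbT.
  case: (ltnP x m) => xm'.
    exists A, m, (rcons B x), [::]; split => //.
    - by rewrite cats0 E rcons_cat.
    - by case: (B).
    - by rewrite all_rcons Bm /= xm'.
    by rewrite /tail_of /= allrel0r.
  have mx : m < x by rewrite ltn_neqAle eq_sym xm.
  exists A, m, B, [:: x]; split => //; first by rewrite E cats1 rcons_cat.
  rewrite /tail_of /= allrel_consr allrel0r andbT all_cat /= mx.
  by rewrite (sub_all _ Am) ?(sub_all _ Bm) // => z /= /ltn_trans; apply.
have tx : t != x.
  by apply: contraNneq xw => <-; rewrite E !(mem_cat, inE, mem_rcons) eqxx !orbT.
have Tt : all (ltn^~ t) T.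
  move: sT; rewrite -cats1 sorted_pairwise; last exact: ltn_trans.
  by rewrite pairwise_cat allrel_consr => /and3P[/andP[]] //.
move: (aT); rewrite -cats1 allrel_catr => /andP[aT' ].
rewrite allrel_consr allrel0r andbT => Wt.
case: (ltnP t x) => [ltyx|lexy].
  exists A, m, B, (rcons (rcons T t) x); split => //.
    by rewrite E -!cats1 -!catA /= -!catA.
  apply/andP; split.
    rewrite -!cats1 -catA /= sorted_cat_cons /= sT /=.
    by rewrite ltyx.
  rewrite -(cats1 _ x) allrel_catr aT /= allrel_consr allrel0r andbT.
  by apply: (sub_all _ Wt) => z /= /ltn_trans; apply.
(* The last entry [t] of the old tail is the maximum and is now followed by the smaller [x], so it
   replaces [m] as the largest descent top. *)
exists (A ++ m :: B ++ T), t, [:: x], [::]; split => //=.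
- by rewrite E -!cats1 -!catA /= -!catA.
- by rewrite -cat_cons catA all_cat Tt andbT.
- by rewrite ltn_neqAle eq_sym tx lexy.
by rewrite /tail_of /= allrel0r.
Qed.

(** * Decomposition at the largest descent top *)

Section Decomposition.

Variables (A B T1 T2 : seq nat) (m t : nat).
Local Notation w := (A ++ m :: B ++ T1 ++ t :: T2).
Local Notation w1 := (A ++ m :: T2).
Local Notation w2 := (B ++ T1).
Local Notation pos v := (index v w).

Hypotheses (uniq_w : uniq w) (B_neq0 : B != [::]).
Hypotheses (lt_Am : all (ltn^~ m) A) (lt_Bm : all (ltn^~ m) B).
Hypothesis tail_T : tail_of (A ++ m :: B) (T1 ++ t :: T2).

Let size_w : size w = (size A + size w2 + size T2).+2.
Proof. by rewrite !size_cat /= !size_cat /=; lia. Qed.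

(** From here on, membership in each block becomes a linear condition on [pos v], so that [lia] can
    settle where hooks start and end. *)
Let in_w v : (v \in w) = (pos v < size w).
Proof. exact: mem_indexE. Qed.

Let in_A v : (v \in A) = (pos v < size A).
Proof. exact: (@mem_index_block v [::] A (m :: B ++ T1 ++ t :: T2)). Qed.

Let in_m v : (v == m) = (pos v == size A).
Proof.
have := @mem_index_block v A [:: m] (B ++ T1 ++ t :: T2).
by move=> /(_ uniq_w); rewrite inE => -> /=; lia.
Qed.

Let in_w2 v : (v \in w2) = (size A < pos v <= size A + size w2).
Proof.
have E : w = rcons A m ++ w2 ++ t :: T2 by rewrite cat_rcons -catA.
by move: uniq_w; rewrite E => /mem_index_block ->; rewrite size_rcons; lia.
Qed.

Let in_t v : (v == t) = (pos v == (size A + size w2).+1).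
Proof.
have E : w = (A ++ m :: w2) ++ [:: t] ++ T2 by rewrite -!catA /= -!catA.
move: uniq_w; rewrite E => /(mem_index_block v); rewrite inE => ->.
by rewrite size_cat /=; lia.
Qed.

Let in_T2 v : (v \in T2) = ((size A + size w2).+1 < pos v < size w).
Proof.
have E : w = (A ++ m :: w2 ++ [:: t]) ++ T2 ++ [::].
  by rewrite cats0 -!catA /= -!catA.
move: uniq_w; rewrite size_w E => /mem_index_block ->.
by rewrite !size_cat /= !size_cat /=; lia.
Qed.

Let in_w1 v : (v \in w1) =
  (pos v <= size A) || ((size A + size w2).+1 < pos v < size w).
Proof. by rewrite mem_cat inE in_A in_m in_T2; lia. Qed.

Let pos_m : pos m = size A.
Proof. by apply/eqP; rewrite -in_m. Qed.

Let pos_t : pos t = (size A + size w2).+1.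
Proof. by apply/eqP; rewrite -in_t. Qed.

Let lt_tail v y : v \in w -> pos v < pos y ->
  size A + size w2 < pos y < size w -> v < y.
Proof.
have E : w = (A ++ m :: B) ++ T1 ++ t :: T2 by rewrite -catA.
move=> vw vy yp; apply: (@ltn_tail (A ++ m :: B) (T1 ++ t :: T2)) => //.
- by rewrite -E.
- by rewrite -E.
- have : (y == t) || (y \in T2) by rewrite in_t in_T2; lia.
  by rewrite mem_cat inE => ->; rewrite orbT.
- by rewrite -E.
Qed.

Let w1_lt x y : x \in w1 -> y \in w1 ->
  (index x w1 < index y w1) = (pos x < pos y).
Proof.
apply: index_subseq_lt => //; apply: cat_subseq => //=; rewrite eqxx.
by rewrite catA; apply: subseq_trans (suffix_subseq _ _); apply: subseq_cons.
Qed.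

Let w2_lt x y : x \in w2 -> y \in w2 ->
  (index x w2 < index y w2) = (pos x < pos y).
Proof.
apply: index_subseq_lt => //; rewrite [X in subseq _ (_ ++ m :: X)]catA.
apply: subseq_trans (suffix_subseq _ _).
by apply: subseq_trans (subseq_cons _ _); apply: prefix_subseq.
Qed.

Lemma descent_tops_w : descent_tops w = descent_tops A ++ m :: descent_tops B.
Proof.
have E : w = (A ++ m :: B) ++ T1 ++ t :: T2 by rewrite -catA.
rewrite E descent_tops_tail // descent_tops_cat //=.
case: B B_neq0 lt_Bm => //= b B' _ /andP[bm _].
by rewrite bm.
Qed.

(** With [B] removed, [m] is no longer a descent top and joins the tail; the first factor therefore
    has the descents of [A] alone. *)
Lemma tail_w1 : tail_of A (m :: T2).
Proof.
case/andP: tail_T => sT aT; apply/andP; split.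
  rewrite /= path_min_sorted; last first.
    move: aT; rewrite allrel_catl allrel_consl => /and3P[_ + _].
    by rewrite all_cat /= => /and3P[].
  by move: sT; rewrite sorted_cat_cons /= => /andP[_ /path_sorted].
rewrite allrel_consr lt_Am; move: aT.
by rewrite allrel_catl allrel_catr allrel_consr => /andP[/and3P[]].
Qed.

Lemma tail_w2 : tail_of B T1.
Proof.
case/andP: tail_T => sT aT; apply/andP; split; first exact: (cat_sorted2 sT).1.
by move: aT; rewrite allrel_catl allrel_consl !allrel_catr => /and3P[_ _ /andP[]].
Qed.

Let dtA u : u \in descent_tops A -> pos u < size A.
Proof. by move/descent_tops_sub; rewrite in_A. Qed.

Let dtB u : u \in descent_tops B -> size A < pos u <= size A + size w2.
Proof. by move/descent_tops_sub => uB; rewrite -in_w2 mem_cat uB. Qed.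

Let dtA_w1 u : u \in descent_tops A -> u \in w1.
Proof. by move/dtA/ltnW => uA; rewrite in_w1 uA. Qed.

Let dtB_w2 u : u \in descent_tops B -> u \in w2.
Proof. by move/dtB; rewrite in_w2. Qed.

Let w1_sub v : v \in w1 -> v \in w.
Proof. by rewrite in_w1 in_w size_w; lia. Qed.

Let w2_sub v : v \in w2 -> v \in w.
Proof. by rewrite in_w2 in_w size_w; lia. Qed.

Let dtw u : u \in descent_tops w =
  [|| u \in descent_tops A, u == m | u \in descent_tops B].
Proof. by rewrite descent_tops_w mem_cat inE. Qed.

Let dt1 : descent_tops w1 = descent_tops A.
Proof. exact: descent_tops_tail tail_w1. Qed.

Let dt2 : descent_tops w2 = descent_tops B.
Proof. exact: descent_tops_tail tail_w2. Qed.

(** A hook starting in [A] either ends no later than [m] or passes over [m]; in the second case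
    nesting pushes its end beyond [t], into [T2]. *)
Lemma ne_in_w1 J : hook_configuration w J -> J m = t ->
  {in descent_tops A, forall u, J u \in w1}.
Proof.
move=> H Jm u du; have pu := dtA du.
have [|Jw _ _ nest] := H u; first by rewrite dtw du.
move: Jw (nest m); rewrite in_w1 in_w dtw eqxx orbT Jm pos_t => Jw /(_ isT).
by rewrite /sheltered pos_m; lia.
Qed.

(** A hook starting in [B] starts under the hook of [m], so nesting makes it end before [t]. *)
Lemma ne_in_w2 J : hook_configuration w J -> J m = t ->
  {in descent_tops B, forall u, J u \in w2}.
Proof.
move=> H Jm u du; have pu := dtB du.
have [|_ lt _ _] := H u; first by rewrite dtw du !orbT.
have [|_ _ _ nest] := H m; first by rewrite dtw eqxx orbT.
move: (nest u); rewrite in_w2 dtw du !orbT Jm /sheltered Jm pos_m pos_t.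
by move=> /(_ isT); lia.
Qed.

(** A hook of [w1] reaching past [m] passes over all of [w2] and [t], while a hook of [w2] stays
    between [m] and [t]; hence no condition couples the two families. *)
Lemma hook_configuration_split J : J m = t ->
  hook_configuration w J <->
  hook_configuration w1 J /\ hook_configuration w2 J.
Proof.
move=> Jm; split=> [H|[H1 H2] u].
- have J1 := ne_in_w1 H Jm; have J2 := ne_in_w2 H Jm.
  split=> u; rewrite ?dt1 ?dt2 => du.
  + have [|Jw lt above nest] := H u; first by rewrite dtw du.
    have pu := dtA du; have Ju := J1 u du.
    have u1 := dtA_w1 du.
    split=> //; first by rewrite w1_lt.
    * move=> v v1; rewrite leqNgt !w1_lt // -leqNgt; apply: above.
      exact: w1_sub.
    * move=> v dv; have v1 := dtA_w1 dv.
      rewrite /sheltered !w1_lt ?J1 // => /nest.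
      by rewrite dtw dv => /(_ isT).
  + have [|Jw lt above nest] := H u; first by rewrite dtw du !orbT.
    have pu := dtB du; have Ju := J2 u du.
    have u2 := dtB_w2 du.
    split=> //; first by rewrite w2_lt.
    * move=> v v2; rewrite leqNgt !w2_lt // -leqNgt; apply: above.
      exact: w2_sub.
    * move=> v dv; have v2 := dtB_w2 dv.
      rewrite /sheltered !w2_lt ?J2 // => /nest.
      by rewrite dtw dv !orbT => /(_ isT).
have J1 v : v \in descent_tops A -> J v \in w1 /\ pos v < pos (J v).
  move=> dv; have [|Jv lt _ _] := H1 v; first by rewrite dt1.
  by rewrite -w1_lt // dtA_w1.
have J2 v : v \in descent_tops B -> J v \in w2 /\ pos v < pos (J v).
  move=> dv; have [|Jv lt _ _] := H2 v; first by rewrite dt2.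
  by rewrite -w2_lt // dtB_w2.
rewrite dtw => /or3P[du|/eqP ->|du].
- have pu := dtA du; have [Ju lt] := J1 u du.
  have [|_ _ above nest] := H1 u; first by rewrite dt1.
  have u1 := dtA_w1 du.
  split=> //.
  + exact: w1_sub.
  + move=> v vw vb; case v1 : (v \in w1).
      by apply: above => //; rewrite leqNgt !w1_lt // -leqNgt.
    (* Here [v] lies after [m] and no later than [t], so the hook of [u] ends in [T2], above
       everything to its left. *)
    apply: lt_tail => //; first by case/andP: vb.
    by move: Ju v1; rewrite !in_w1 size_w; lia.
  + move=> v; rewrite dtw /sheltered => /or3P[dv|/eqP ->|dv] vb.
    * have v1 := dtA_w1 dv.
      have [Jv _] := J1 v dv; rewrite -w1_lt //; apply: nest; first by rewrite dt1.
      by rewrite /sheltered !w1_lt.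
    * by move: Ju vb; rewrite Jm in_w1 pos_t pos_m; lia.
    * have [Jv _] := J2 v dv; move: Jv Ju vb (dtB dv).
      by rewrite in_w1 in_w2; lia.
- rewrite Jm; split.
  + by rewrite in_w pos_t size_w; lia.
  + by rewrite pos_t pos_m; lia.
  + move=> v vw; rewrite pos_m pos_t => vb; apply: lt_tail => //; rewrite pos_t.
      by lia.
    by rewrite size_w; lia.
  + move=> v; rewrite dtw /sheltered Jm pos_m pos_t.
    case/or3P=> [/dtA|/eqP ->|dv _]; [lia|by rewrite pos_m; lia|].
    by have [] := J2 v dv; rewrite in_w2; lia.
- have pu := dtB du; have [Ju lt] := J2 u du.
  have [|_ _ above nest] := H2 u; first by rewrite dt2.
  have u2 := dtB_w2 du.
  split=> //.
  + exact: w2_sub.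
  + move=> v vw vb; have v2 : v \in w2 by move: Ju; rewrite !in_w2; lia.
    by apply: above => //; rewrite leqNgt !w2_lt // -leqNgt.
  + move=> v; rewrite dtw /sheltered => /or3P[/dtA|/eqP ->|dv] vb; first by lia.
      by move: vb; rewrite pos_m; lia.
    have v2 := dtB_w2 dv.
    have [Jv _] := J2 v dv; rewrite -w2_lt //; apply: nest; first by rewrite dt2.
    by rewrite /sheltered !w2_lt.
Qed.

(* Every point of [w2] lies below the hook of [m], which therefore plays the
   role of the sky in the factor [w2]. *)
Lemma composition_split J : J m = t -> hook_configuration w J ->
  composition_of w J = composition_of w1 J ++ composition_of w2 J.
Proof.
move=> Jm H; have J1 := ne_in_w1 H Jm; have J2 := ne_in_w2 H Jm.
have ne1 v : v \in w1 ->
    (v \in map J (descent_tops w)) = (v \in map J (descent_tops w1)).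
  move=> v1; rewrite dt1 descent_tops_w map_cat mem_cat /= inE Jm in_t.
  rewrite [v \in map J (descent_tops B)](_ : _ = false); last first.
    apply: contraTF v1 => /mapP[u du ->]; move: (J2 u du).
    by rewrite in_w1 in_w2; lia.
  by move: v1; rewrite in_w1; case: (v \in _) => //=; lia.
have ne2 v : v \in w2 ->
    (v \in map J (descent_tops w)) = (v \in map J (descent_tops w2)).
  move=> v2; rewrite dt2 descent_tops_w map_cat mem_cat /= inE Jm in_t.
  rewrite [v \in map J (descent_tops A)](_ : _ = false); last first.
    apply: contraTF v2 => /mapP[u du ->]; move: (J1 u du).
    by rewrite in_w1 in_w2; lia.
  by move: v2; rewrite in_w2; case: (v \in _) => //=; lia.
have A1 u v : v \in w1 -> u \in descent_tops A ->
    sheltered w J u v = sheltered w1 J u v.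
  move=> v1 du; have u1 := dtA_w1 du.
  by rewrite /sheltered !w1_lt ?J1.
have m1 v : v \in w1 -> sheltered w J m v = false.
  by rewrite in_w1 /sheltered Jm pos_m pos_t; lia.
have B1 u v : v \in w1 -> u \in descent_tops B -> sheltered w J u v = false.
  move=> + du; move: (J2 u du) (dtB du).
  by rewrite in_w1 in_w2 /sheltered; lia.
have B2 u v : v \in w2 -> u \in descent_tops B ->
    sheltered w J u v = sheltered w2 J u v.
  move=> v2 du; have u2 := dtB_w2 du.
  by rewrite /sheltered !w2_lt ?J2.
have m2 v : v \in w2 -> sheltered w J m v.
  by rewrite in_w2 /sheltered Jm pos_m pos_t; lia.
(* Over a point of [w2], hooks from [A] are higher than the hook of [m] and never give the color; by
   [B2t] below, hooks from [B] are lower and take precedence over it. *)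
have A2 u v : v \in w2 -> u \in descent_tops A -> sheltered w J u v -> t < J u.
  move=> v2 du; rewrite /sheltered => suv; apply: lt_tail.
  - by rewrite in_w pos_t size_w; lia.
  - by move: (J1 u du) v2 suv; rewrite in_w1 in_w2 pos_t; lia.
  - by move: (J1 u du) v2 suv; rewrite in_w1 in_w2 size_w; lia.
have B2t u : u \in descent_tops B -> J u < t.
  move=> du; move: (J2 u du); rewrite in_w2 => Ju.
  by apply: lt_tail; rewrite ?in_w ?pos_t ?size_w; lia.
have sky1 v : v \in w1 -> skyward w J v = skyward w1 J v.
  move=> v1; rewrite /skyward dt1 descent_tops_w has_cat /= m1 //=.
  rewrite [has _ (descent_tops B)](_ : _ = false) ?orbF.
    by congr negb; apply: eq_in_has => u; apply: A1.
  by apply/negP => /hasP[u du]; rewrite B1.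
have sky2 v : v \in w2 -> skyward w J v = false.
  move=> v2; rewrite /skyward descent_tops_w has_cat /= m2 //.
  by rewrite orbT.
have low1 u v : v \in w1 -> u \in descent_tops A ->
    lowest_over w J u v = lowest_over w1 J u v.
  move=> v1 du; rewrite /lowest_over dt1 descent_tops_w all_cat /= m1 //= A1 //.
  rewrite [all _ (descent_tops B)](_ : _ = true) ?andbT.
    by congr (_ && _); apply: eq_in_all => u' du'; rewrite A1.
  by apply/allP => u' du'; rewrite B1.
have low2A u v : v \in w2 -> u \in descent_tops A -> lowest_over w J u v = false.
  move=> v2 du; apply/negP => /andP[/(A2 _ _ v2 du) tJ].
  move=> /allP/(_ m); rewrite dtw eqxx orbT m2 // Jm => /(_ isT) /=.
  by rewrite leqNgt tJ.
have low2m v : v \in w2 -> lowest_over w J m v = skyward w2 J v.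
  move=> v2; rewrite /lowest_over m2 //= /skyward dt2 -all_predC.
  rewrite descent_tops_w all_cat /= Jm leqnn implybT /=.
  rewrite [all _ (descent_tops A)](_ : _ = true) /=.
    apply: eq_in_all => u' du' /=; rewrite B2 // [t <= _]leqNgt B2t //.
  apply/allP => u' du'; apply/implyP => /(A2 _ _ v2 du') ltJ.
  exact: ltnW.
have low2B u v : v \in w2 -> u \in descent_tops B ->
    lowest_over w J u v = lowest_over w2 J u v.
  move=> v2 du; rewrite /lowest_over B2 // dt2 descent_tops_w all_cat /= Jm.
  rewrite (ltnW (B2t u du)) implybT /=.
  rewrite [all _ (descent_tops A)](_ : _ = true) /=.
    by congr (_ && _); apply: eq_in_all => u' du' /=; rewrite B2.
  apply/allP => u' du'; apply/implyP => /(A2 _ _ v2 du') ltJ.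
  by apply: ltnW; apply: ltn_trans (B2t u du) ltJ.
have cnt c c1 c2 : {in w1, c =1 c1} -> {in w2, c =1 c2} ->
    num_points w J c = num_points w1 J c1 + num_points w2 J c2.
  move=> e1 e2; rewrite /num_points.
  have -> : count (fun v => (v \notin map J (descent_tops w)) && c v) w =
    count (fun v => (v \notin map J (descent_tops w)) && c v) w1 +
    count (fun v => (v \notin map J (descent_tops w)) && c v) w2.
    (* The only entry of [w] outside both factors is [t], a northeast endpoint, which is not
       counted. *)
    have tne : t \in map J (descent_tops w).
      by apply/mapP; exists m; rewrite ?Jm // dtw eqxx orbT.
    by rewrite !count_cat /= !count_cat /= tne /=; clear; lia.
  congr (_ + _); apply: eq_in_count => v vi; first by rewrite ne1 // e1.
  by rewrite ne2 // e2.
have no0 s : num_points s J pred0 = 0.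
  by rewrite /num_points -(count_pred0 s); apply: eq_count => v; rewrite andbF.
rewrite /composition_of descent_tops_w map_cat dt1 dt2 /= -cat_cons.
congr (_ :: _ ++ _ :: _).
- by rewrite (cnt _ (skyward w1 J) pred0) ?no0 ?addn0.
- apply/eq_in_map => u du; rewrite (cnt _ (lowest_over w1 J u) pred0) ?no0 ?addn0 //.
  + by move=> v v1; apply: low1.
  + by move=> v v2; apply: low2A.
- rewrite (cnt _ pred0 (skyward w2 J)) ?no0 //.
  by move=> v v1; rewrite /lowest_over m1.
- apply/eq_in_map => u du; rewrite (cnt _ pred0 (lowest_over w2 J u)) ?no0 //.
  + by move=> v v1; rewrite /lowest_over B1.
  + by move=> v v2; apply: low2B.
Qed.

End Decomposition.

(** * Gluing configurations of the two factors *)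

Lemma eq_hook_configuration w J J' : {in descent_tops w, J =1 J'} ->
  hook_configuration w J -> hook_configuration w J'.
Proof.
move=> eJ H u du; have [Ju lt above nest] := H u du.
rewrite /sheltered -!eJ //; split=> // v dv; rewrite -eJ //.
exact: nest.
Qed.

Lemma eq_composition_of w J J' : {in descent_tops w, J =1 J'} ->
  composition_of w J = composition_of w J'.
Proof.
move=> eJ; have e : map J (descent_tops w) = map J' (descent_tops w).
  exact/eq_in_map.
rewrite /composition_of /num_points -e; congr (_ :: _).
  apply: eq_count => v; congr (_ && ~~ _).
  by apply: eq_in_has => u du; rewrite /sheltered eJ.
apply/eq_in_map => u du; apply: eq_count => v; congr (_ && _).
rewrite /lowest_over /sheltered eJ //; congr (_ && _).
by apply: eq_in_all => u' du'; rewrite !eJ.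
Qed.

Lemma valid_composition_split (A : seq nat) (m : nat) (B T q : seq nat) :
  uniq (A ++ m :: B ++ T) ->
  B != [::] -> all (ltn^~ m) A -> all (ltn^~ m) B ->
  tail_of (A ++ m :: B) T ->
  valid_composition (A ++ m :: B ++ T) q <->
  exists (T1 : seq nat) (t : nat) (T2 q1 q2 : seq nat), [/\
    T = T1 ++ t :: T2, q = q1 ++ q2,
    valid_composition (A ++ m :: T2) q1 & valid_composition (B ++ T1) q2].
Proof.
move=> uw B0 Am Bm tT; split=> [[J H ->]|].
  (* A hook ends higher than it starts, and only the entries of [T] exceed [m]. *)
  have JT : J m \in T.
    have [|Jw lt above _] := H m.
      have E : A ++ m :: B ++ T = (A ++ m :: B) ++ T by rewrite -catA.
      rewrite E descent_tops_tail // descent_tops_cat //= mem_cat.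
      by case: (B) B0 Bm => //= b B' _ /andP[-> _]; rewrite mem_head orbT.
    have ltJ : m < J m by apply: above; rewrite ?leqnn // mem_cat mem_head orbT.
    move: Jw; rewrite mem_cat inE mem_cat => /or4P[JA|/eqP Jm|JB|//].
    - by have := allP Am _ JA; rewrite /= ltnNge ltnW.
    - by rewrite Jm ltnn in ltJ.
    - by have := allP Bm _ JB; rewrite /= ltnNge ltnW.
  move Et: (J m) JT => t JT; case/splitPr: JT uw tT H => T1 T2 uw tT H.
  exists T1, t, T2, (composition_of (A ++ m :: T2) J), (composition_of (B ++ T1) J).
  have [H1 H2] := (hook_configuration_split uw B0 Am Bm tT Et).1 H.
  by split=> //; [apply: composition_split|exists J|exists J].
case=> T1 [t [T2 [q1 [q2 [ET -> [J1 H1 ->] [J2 H2 ->]]]]]].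
rewrite {}ET in uw tT *.
(* The southwest endpoints of the two factors lie in the disjoint blocks [A] and [B], so the two
   functions can be glued. *)
pose J u := if u \in A then J1 u else if u == m then t else J2 u.
have dA := descent_tops_tail (tail_w1 Am tT).
have dB := descent_tops_tail (tail_w2 tT).
have mA : m \notin A by apply/negP => /(allP Am); rewrite /= ltnn.
have Jm : J m = t by rewrite /J (negPf mA) eqxx.
have e1 : {in descent_tops (A ++ m :: T2), J1 =1 J}.
  by move=> u; rewrite dA /J => /descent_tops_sub ->.
have e2 : {in descent_tops (B ++ T1), J2 =1 J}.
  move=> u; rewrite dB /J => /descent_tops_sub uB.
  have -> : (u \in A) = false.
    apply: contraTF uw; rewrite cat_uniq => uA.
    rewrite negb_and negb_and; apply/orP; right; apply/orP; left.
    by apply/negPn/hasP; exists u => //; rewrite inE mem_cat uB orbT.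
  by rewrite ltn_eqF //; apply: (allP Bm).
have {}H1 := eq_hook_configuration e1 H1.
have {}H2 := eq_hook_configuration e2 H2.
have H := (hook_configuration_split uw B0 Am Bm tT Jm).2 (conj H1 H2).
exists J => //; rewrite (composition_split uw B0 Am Bm tT Jm H).
by rewrite (eq_composition_of e1) (eq_composition_of e2).
Qed.

(** * Linear constraints on valid compositions *)

(* A pair (b, z) is the constraint that the entries selected by the mask b have
   sum at least z. *)
Definition satisfies (cs : seq (bitseq * nat)) (q : seq nat) : bool :=
  all (fun c => c.2 <= sumn (mask c.1 q)) cs.

(** Padding by [false] leaves the entries of the other factor free. The bounds [z1] and [z2] are
    what survives of the two total-sum equations once the splitting point of the tail may vary. *)
Definition join_constraints (cs1 cs2 : seq (bitseq * nat)) (k1 k2 z1 z2 : nat) :=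
  [seq (c.1 ++ nseq k2 false, c.2) | c <- cs1] ++
  [seq (nseq k1 false ++ c.1, c.2) | c <- cs2] ++
  [:: (nseq k1 true ++ nseq k2 false, z1); (nseq k1 false ++ nseq k2 true, z2)].

Lemma satisfies_join cs1 cs2 z1 z2 q1 q2 :
  all (fun c => size c.1 == size q1) cs1 ->
  satisfies (join_constraints cs1 cs2 (size q1) (size q2) z1 z2) (q1 ++ q2) =
  [&& satisfies cs1 q1, satisfies cs2 q2, z1 <= sumn q1 & z2 <= sumn q2].
Proof.
move=> s1; rewrite /satisfies /join_constraints !all_cat !all_map /=.
rewrite !mask_cat ?size_nseq // !sumn_cat !mask_false !mask_true //= addn0 andbT.
congr [&& _, _, _ & _].
  apply: eq_in_all => c /(allP s1)/eqP sc /=.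
  by rewrite mask_cat // mask_false cats0.
by apply: eq_in_all => c _ /=; rewrite mask_cat ?size_nseq // mask_false.
Qed.

(** The list [cs] is chosen before [T]: the induction applies the result to [A] and [B] with tails
    that depend on the choice of [t]. *)
Lemma valid_composition_polyhedral (w : seq nat) : uniq w -> exists2 cs,
  all (fun c => size c.1 == (size (descent_tops w)).+1) cs &
  forall T : seq nat, uniq (w ++ T) -> tail_of w T -> forall q,
  valid_composition (w ++ T) q <->
  [/\ size q = (size (descent_tops w)).+1,
      sumn q + size (descent_tops w) = size w + size T & satisfies cs q].
Proof.
have [n] := ubnP (size w); elim: n => // n IH in w * => + uw.
case: (descent_split uw) => [sw _|[A [m [B [T0 [E B0 Am Bm tT0]]]]]].
  exists [::] => // T uT tT q.
  rewrite (descent_tops_sorted sw) addn0 -size_cat.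
  have e J : composition_of (w ++ T) J = [:: size (w ++ T)].
    rewrite /composition_of /num_points /skyward descent_tops_tail //.
    by rewrite (descent_tops_sorted sw) /= count_predT.
  split=> [[J _ ->]|[sq sumq _]]; first by rewrite e /= addn0.
  (* There are no hooks, so any function serves; the sky receives every point. *)
  exists id; first by move=> u; rewrite descent_tops_tail ?descent_tops_sorted.
  by rewrite e; case: q sq sumq => [|x []] //= _; rewrite addn0 => ->.
have E' : w = (A ++ m :: B) ++ T0 by rewrite -catA.
move=> sz; have uA : uniq A by move: uw; rewrite E cat_uniq => /and3P[].
have uB : uniq B.
  by move: uw; rewrite E cat_uniq /= cat_uniq => /and5P[].
have sw : size w = (size A + size B + size T0).+1.
  by rewrite E size_cat /= size_cat; lia.
have [||csA szA HA] := IH A; [by lia|by []|].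
have [||csB szB HB] := IH B; [by lia|by []|].
have dw : descent_tops w = descent_tops A ++ m :: descent_tops B.
  rewrite E' descent_tops_tail // descent_tops_cat //=.
  by case: (B) B0 Bm => //= b B' _ /andP[-> _].
set kA := size (descent_tops A); set kB := size (descent_tops B).
have kw : size (descent_tops w) = (kA + kB).+1 by rewrite dw size_cat /= addnS.
rewrite kw.
(* The factor sums are [(size A).+1 + size T2 - kA] and [size B + size T1 - kB]; the bounds are
   their values for empty [T2] and empty [T1]. *)
exists (join_constraints csA csB kA.+1 kB.+1 ((size A).+1 - kA) (size B - kB)).
  rewrite !all_cat !all_map; apply/and3P; split.
  - by apply: sub_all szA => c /= /eqP sc; rewrite size_cat /= size_nseq sc; lia.
  - by apply: sub_all szB => c /= /eqP sc; rewrite size_cat size_nseq sc; lia.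
  - by rewrite /= !size_cat /= !size_nseq; lia.
move=> T uT tT q.
have {}E T' : T' = T0 ++ T -> w ++ T = A ++ m :: B ++ T'.
  by move=> ->; rewrite E -!catA /= -!catA.
have tT' : tail_of (A ++ m :: B) (T0 ++ T).
  case/andP: tT0 tT => s0 a0 /andP[sT aT]; apply/andP; split.
    rewrite sorted_pairwise; last exact: ltn_trans.
    rewrite pairwise_cat -!sorted_pairwise ?s0 ?sT ?andbT; try exact: ltn_trans.
    by move: aT; rewrite E' allrel_catl => /andP[].
  by rewrite allrel_catr a0; move: aT; rewrite E' allrel_catl => /andP[].
have sub1 (T1 : seq nat) (t : nat) (T2 : seq nat) : T0 ++ T = T1 ++ t :: T2 ->
    [/\ uniq (A ++ m :: T2), tail_of A (m :: T2), uniq (B ++ T1) & tail_of B T1].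
  move=> ET; rewrite ET in tT'; move: uT; rewrite (E _ (esym ET)) => uT.
  split.
  - apply: subseq_uniq uT; apply: cat_subseq => //=; rewrite eqxx.
    by rewrite catA; apply: subseq_trans (suffix_subseq _ _); apply: subseq_cons.
  - exact: tail_w1 Am tT'.
  - apply: subseq_uniq uT; rewrite [X in subseq _ (_ ++ m :: X)]catA.
    apply: subseq_trans (suffix_subseq _ _).
    by apply: subseq_trans (subseq_cons _ _); apply: prefix_subseq.
  - exact: tail_w2 tT'.
rewrite (E _ erefl) in uT *.
have := valid_composition_split q uT B0 Am Bm tT' => ->.
have leA : kA <= size A := size_subseq (descent_tops_subseq A).
have leB : kB <= size B := size_subseq (descent_tops_subseq B).
have sT : size (T0 ++ T) = size T0 + size T by rewrite size_cat.
split=> [[T1 [t [T2 [q1 [q2 [ET -> v1 v2]]]]]]|[sq sumq]].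
  have [u1 t1 u2 t2] := sub1 _ _ _ ET.
  have [s1 sum1 c1] := (HA _ u1 t1 q1).1 v1.
  have [s2 sum2 c2] := (HB _ u2 t2 q2).1 v2.
  move: sT; rewrite ET size_cat /= -/kA -/kB in sum1 sum2 s1 s2 * => sT.
  rewrite size_cat sumn_cat -s1 -s2 satisfies_join ?c1 ?c2 /=; last by rewrite s1.
  by clear -s1 s2 sum1 sum2 sT sw leA leB; split; lia.
rewrite -(cat_take_drop kA.+1 q).
set q1 := take _ _; set q2 := drop _ _.
have s1 : size q1 = kA.+1 by rewrite size_takel // sq ltnS -addnS leq_addr.
have s2 : size q2 = kB.+1 by rewrite size_drop sq; clear; lia.
have sumE : sumn q = sumn q1 + sumn q2 by rewrite -sumn_cat cat_take_drop.
rewrite -s1 -s2 satisfies_join; last by rewrite s1.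
case/and4P=> c1 c2 z1 z2.
(* The sum of [q2] forces the length [a] of [T1]. The bound [z2] keeps the subtraction from
   truncating, and [z1] leaves an entry of the tail to serve as [t]. *)
pose a := sumn q2 + kB - size B.
have la : a < size (T0 ++ T) by rewrite sT /a; clear -s1 s2 sumq sumE sw leA leB z1 z2; lia.
have ET : T0 ++ T = take a (T0 ++ T) ++ nth 0 (T0 ++ T) a :: drop a.+1 (T0 ++ T).
  by rewrite -drop_nth // cat_take_drop.
have [u1 t1 u2 t2] := sub1 _ _ _ ET.
exists (take a (T0 ++ T)), (nth 0 (T0 ++ T) a), (drop a.+1 (T0 ++ T)), q1, q2.
split=> //.
- apply/(HA _ u1 t1); split=> //.
  move: la; rewrite /= size_drop sT -/kA /a.
  by clear -s1 s2 sumq sumE sw leA leB z1 z2; lia.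
- apply/(HB _ u2 t2); split=> //.
  rewrite size_takel; last exact: ltnW.
  by rewrite -/kB /a; clear -s2 sumE leB z2; lia.
Qed.

(** * From plots to words *)

Lemma descent_topsE (w : seq nat) : descent_tops w =
  [seq nth 0 w i | i <- iota 0 (size w).-1 & nth 0 w i.+1 < nth 0 w i].
Proof.
elim: w => // x [|y w] IH; first by rewrite /= ltnn.
have E : iota 0 (size (x :: y :: w)).-1 = 0 :: map succn (iota 0 (size (y :: w)).-1).
  by rewrite -[succn]/(addn 1) -iotaDl.
rewrite {}E [LHS]/= -/(descent_tops (y :: w)) IH.
rewrite [filter _ (_ :: _)]/= filter_map.
by case: ifP; rewrite [RHS]/= -map_comp.
Qed.

Section Points.

Variables (n : nat) (p : n.-tuple nat).
Hypothesis uniq_p : uniq p.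

Lemma index_tnth (m : 'I_n) : index (tnth p m) p = m.
Proof. by rewrite (tnth_nth 0) index_uniq // size_tuple. Qed.

Lemma tnth_injective (i j : 'I_n) : tnth p i = tnth p j -> i = j.
Proof. by move=> e; apply: val_inj; rewrite /= -index_tnth e index_tnth. Qed.

Lemma size_descent_tops_tuple : size (descent_tops p) = ndes p.
Proof. by rewrite descent_topsE size_map size_tuple. Qed.

Lemma mem_descent_topsP v :
  reflect (exists a : 'I_(ndes p), v = nth 0 (descent_tops p) a)
          (v \in descent_tops p).
Proof.
apply: (iffP idP) => [vD|[a ->]]; last by rewrite mem_nth // size_descent_tops_tuple.
have lt : index v (descent_tops p) < ndes p by rewrite -size_descent_tops_tuple index_mem.
by exists (Ordinal lt); rewrite nth_index.
Qed.

Local Open Scope ring_scope.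

(** If the second hook starts under the first without being nested in it, its vertical segment
    crosses the horizontal segment of the first. Conversely, the vertical segment of the first lies
    left of the second hook, so a common point is on the horizontal one. *)
Lemma hooks_disjointP (R : realType) (h1 h2 : hook p) :
  (forall m, ~~ directly_above h1 m) -> (forall m, ~~ directly_above h2 m) ->
  (sw h1 < sw h2)%N ->
  (forall z, hook_points R h1 z -> hook_points R h2 z ->
    (z = plot_point R p (ne h1) /\ z = plot_point R p (sw h2)) \/
    (z = plot_point R p (ne h2) /\ z = plot_point R p (sw h1))) <->
  ((sw h2 < ne h1)%N -> (ne h2 < ne h1)%N).
Proof.
move=> above1 above2 lt; split.
- move=> disj lt21; rewrite ltnNge; apply/negP => le12.
  have le_sw : (tnth p (sw h2) <= tnth p (ne h1))%N.
    by have := above1 (sw h2); rewrite /directly_above lt lt21 -leqNgt.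
  have le_ne : (tnth p (ne h1) <= tnth p (ne h2))%N.
    move: le12; rewrite leq_eqVlt => /orP[/eqP/val_inj ->//|ltne].
    by have := above2 (ne h1); rewrite /directly_above lt21 ltne -leqNgt.
  (* The crossing point: the column of [sw h2] at the height of [ne h1]. It is neither northeast
     endpoint, since [sw h2] lies strictly left of both. *)
  have [||[E _]|[E _]] := disj ((sw h2).+1%:R, (tnth p (ne h1))%:R).
  + by right; split=> //=; rewrite !ler_nat !ltnS (ltnW lt) (ltnW lt21).
  + by left; split=> //=; rewrite !ler_nat le_sw le_ne.
  + case: E => /eqP; rewrite eqr_nat => /eqP; lia.
  + case: E => /eqP; rewrite eqr_nat => /eqP; have := sw_ltn_ne h2; lia.
move=> nested [x y] H1 H2.
have x2 : (sw h2).+1%:R <= x.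
  by case: H2 => [[/= -> _]|[/= /andP[]]].
have [{}H1 yE] : (sw h1).+1%:R <= x <= (ne h1).+1%:R /\ y = (tnth p (ne h1))%:R.
  case: H1 => [[/= xE _]|[] //].
  by move: x2; rewrite xE ler_nat; lia.
rewrite {}yE in H2 *.
have le21 : (sw h2 <= ne h1)%N.
  by case/andP: H1 => _; move/(le_trans x2); rewrite ler_nat.
(* Either the second hook starts where the first ends, the permitted contact, or it is nested and
   stays strictly below the horizontal segment. *)
rewrite leq_eqVlt in le21; case/orP: le21 => [/eqP/val_inj E|lt21].
  left; rewrite E; suff -> : x = (ne h1).+1%:R by [].
  by apply/eqP; rewrite eq_le -{2}E x2; case/andP: H1 => _ ->.
have ltne := nested lt21.
have lty : (tnth p (ne h2) < tnth p (ne h1))%N.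
  have := above1 (ne h2); rewrite /directly_above ltne.
  have -> : (sw h1 < ne h2)%N by apply: ltn_trans lt (sw_ltn_ne h2).
  rewrite -leqNgt leq_eqVlt => /orP[/eqP/tnth_injective E|//].
  by rewrite E ltnn in ltne.
case: H2 => -[/= _].
  by case/andP=> _; rewrite ler_nat leqNgt lty.
by move/eqP; rewrite eqr_nat => /eqP E; rewrite E ltnn in lty.
Qed.

(** * Agreement of plot configurations and word configurations *)

Section Configuration.

Variables (R : realType) (H : 'I_(ndes p) -> hook p) (J : nat -> nat).
Hypothesis sw_H : forall a, sw (H a) = nth 0%N (descents p) a :> nat.
Hypothesis JE : forall a : 'I_(ndes p), J (nth 0%N (descent_tops p) a) = tnth p (ne (H a)).

Local Notation top a := (nth 0%N (descent_tops p) a).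

Let topE (a : 'I_(ndes p)) : top a = tnth p (sw (H a)).
Proof.
rewrite (tnth_nth 0%N) sw_H descent_topsE size_tuple -/(descents p).
by rewrite (nth_map 0%N).
Qed.

Let index_top (a : 'I_(ndes p)) : index (top a) p = sw (H a).
Proof. by rewrite topE index_tnth. Qed.

Let index_J (a : 'I_(ndes p)) : index (J (top a)) p = ne (H a).
Proof. by rewrite JE index_tnth. Qed.

Let shelteredE (a : 'I_(ndes p)) m :
  sheltered p J (top a) (tnth p m) = (sw (H a) < m < ne (H a))%N.
Proof. by rewrite /sheltered index_top index_J index_tnth. Qed.

Let sheltered_topE (a b : 'I_(ndes p)) :
  sheltered p J (top a) (top b) = (sw (H a) < sw (H b) < ne (H a))%N.
Proof. by rewrite /sheltered !index_top index_J. Qed.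

Let top_mem (a : 'I_(ndes p)) : top a \in descent_tops p.
Proof. by apply/mem_descent_topsP; exists a. Qed.

Let sw_inj (a b : 'I_(ndes p)) : sw (H a) = sw (H b) -> a = b.
Proof.
move=> /(congr1 val); rewrite /= !sw_H => /eqP.
rewrite nth_uniq ?ltn_ord ?filter_uniq ?iota_uniq //.
by move=> /eqP; apply: val_inj.
Qed.

Lemma is_vhcP : is_vhc R H <-> hook_configuration p J.
Proof.
split=> [[_ above disj] u /mem_descent_topsP[a ->{u}]|HJ].
  split.
  - by rewrite JE mem_tnth.
  - by rewrite index_top index_J sw_ltn_ne.
  (* The left end of the range, [v] equal to the descent top itself, encodes that the hook rises. *)
  - move=> v /tnthP[m ->{v}]; rewrite index_top index_J index_tnth JE.
    rewrite leq_eqVlt => /andP[/orP[/eqP/val_inj <- _|lt1 lt2]].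
      exact: hook_rises.
    have := above a m; rewrite /directly_above lt1 lt2 -leqNgt leq_eqVlt.
    case/orP=> [/eqP/tnth_injective E|//].
    by rewrite E ltnn in lt2.
  - move=> v /mem_descent_topsP[b ->{v}]; rewrite sheltered_topE !index_J.
    case/andP=> lt1 lt2.
    have ab : a != b by apply: contraTneq lt1 => ->; rewrite ltnn.
    exact: (hooks_disjointP R (above a) (above b) lt1).1 (disj a b ab) lt2.
have above a m : ~~ directly_above (H a) m.
  rewrite /directly_above; apply/negP => /and3P[lt1 lt2].
  have [_ _ /(_ (tnth p m) (mem_tnth _ _)) + _] := HJ _ (top_mem a).
  rewrite index_top index_J index_tnth JE (ltnW lt1) lt2 => /(_ isT).
  by rewrite ltnNge => /negP + /ltnW.
have nested a b : (sw (H a) < sw (H b))%N -> (sw (H b) < ne (H a))%N ->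
    (ne (H b) < ne (H a))%N.
  move=> lt1 lt2; have [_ _ _ /(_ _ (top_mem b))] := HJ _ (top_mem a).
  by rewrite !index_J sheltered_topE lt1 lt2 => /(_ isT).
split=> // a b ab z Ha Hb.
have := contra_neq (@sw_inj a b) ab; rewrite -(inj_eq val_inj) neq_ltn.
case/orP=> lt.
  exact: (hooks_disjointP R (above a) (above b) lt).2 (nested _ _ lt) z Ha Hb.
have := (hooks_disjointP R (above b) (above a) lt).2 (nested _ _ lt) z Hb Ha.
by case; [right|left].
Qed.

Hypothesis vhcH : is_vhc R H.

Let directly_belowE (a : 'I_(ndes p)) m :
  directly_below (H a) m = sheltered p J (top a) (tnth p m).
Proof.
rewrite shelteredE /directly_below andbA; case: (boolP (sw (H a) < m < ne (H a))%N) => //= /andP[lt1 lt2].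
case: vhcH => _ /(_ a m) + _; rewrite /directly_above lt1 lt2 -leqNgt leq_eqVlt.
by case/orP=> [/eqP/tnth_injective E|//]; rewrite E ltnn in lt2.
Qed.

Let is_ne_endpointE m :
  is_ne_endpoint H m = (tnth p m \in map J (descent_tops p)).
Proof.
apply/existsP/mapP => [[a /eqP ->]|[u /mem_descent_topsP[a ->]]].
  by exists (top a).
by rewrite JE => /tnth_injective ->; exists a.
Qed.

(** Of two hooks with the same northeast endpoint, the one starting later would be nested and end
    strictly earlier. Hence the lowest hook is unique and [color] does not depend on the choice made
    by [pick]. *)
Let ne_inj (a b : 'I_(ndes p)) : ne (H a) = ne (H b) -> a = b.
Proof.
move=> E; apply: sw_inj; apply/eqP; rewrite -(inj_eq val_inj) eqn_leq.
have HJ := is_vhcP.1 vhcH.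
have nlt c d : ne (H c) = ne (H d) -> (sw (H c) <= sw (H d))%N.
  move=> Ecd; rewrite leqNgt; apply/negP => lt.
  have [_ _ _ /(_ _ (top_mem c))] := HJ _ (top_mem d).
  by rewrite !index_J sheltered_topE lt -Ecd sw_ltn_ne ltnn => /(_ isT).
by rewrite !nlt.
Qed.

Let lowest_hook_aboveE m a :
  lowest_hook_above H m a = lowest_over p J (top a) (tnth p m).
Proof.
rewrite /lowest_hook_above directly_belowE /lowest_over; congr (_ && _).
apply/forallP/allP => [h u /mem_descent_topsP[b ->]|h b].
  by have := h b; rewrite directly_belowE !JE.
by have := h _ (top_mem b); rewrite directly_belowE !JE.
Qed.

Let color_SomeE m a : (color H m == Some a) = lowest_over p J (top a) (tnth p m).
Proof.
rewrite /color -lowest_hook_aboveE; case: pickP => [b lowb|->//].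
apply/eqP/idP => [[<-]//|lowa]; congr Some; apply: ne_inj; apply: tnth_injective.
case/andP: lowa lowb => da /forallP ma /andP[db /forallP mb].
by apply/eqP; rewrite eqn_leq (implyP (mb a)) ?(implyP (ma b)).
Qed.

Let color_NoneE m : (color H m == None) = skyward p J (tnth p m).
Proof.
rewrite /color; case: pickP => [a /andP[da _]|nolow]; apply/esym.
  apply/negbTE/negPn/hasP; exists (top a) => //.
  by rewrite -directly_belowE.
apply/negP => /hasP[u /mem_descent_topsP[a ->]].
rewrite -directly_belowE => da.
(* A point below some hook has a lowest hook above it, so it is not colored by the sky. *)
have [b db mb] := @arg_minnP _ a (fun a => directly_below (H a) m)
  (fun a => tnth p (ne (H a))) da.
have /negP[] := nolow b; rewrite /lowest_hook_above db /=.
by apply/forallP => c; apply/implyP => /mb.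
Qed.

Let num_pointsE (c : pred nat) (P : pred 'I_n) :
  (forall m, P m = c (tnth p m)) ->
  #|[pred m | ~~ is_ne_endpoint H m & P m]| = num_points p J c.
Proof.
have countE c' : count c' p = #|[pred m | c' (tnth p m)]|.
  by rewrite -{1}(map_tnth_enum p) count_map -size_filter cardE enumT.
move=> E; rewrite /num_points countE; apply: eq_card => m.
by rewrite !inE is_ne_endpointE E.
Qed.

Lemma color_compositionE j :
  color_composition H 0 j = (nth 0%N (composition_of p J) j)%:Z.
Proof.
rewrite mxE; congr Posz; case: (unliftP ord0 j) => [a ->|->] /=.
  rewrite (nth_map 0%N) ?size_descent_tops_tuple // add0n.
  by apply: num_pointsE => m; apply: color_SomeE.
  exact: ltn_ord a.
by apply: num_pointsE => m; apply: color_NoneE.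
Qed.

End Configuration.

Lemma valid_compositionsP (R : realType) (q : 'rV[int]_(ndes p).+1) :
  valid_compositions R p q <->
  exists2 s, valid_composition p s & forall j, q 0 j = (nth 0%N s j)%:Z.
Proof.
split=> [[H vH ->]|[s [J HJ ->] qE]].
  have sw_H : forall a, sw (H a) = nth 0%N (descents p) a :> nat by case: vH.
  (* Off the descent tops [J] takes the default value 0, which no condition reads. *)
  pose J v := nth 0%N [seq tnth p (ne (H a)) | a <- enum 'I_(ndes p)]
                      (index v (descent_tops p)).
  have JE (a : 'I_(ndes p)) : J (nth 0%N (descent_tops p) a) = tnth p (ne (H a)).
    rewrite /J index_uniq ?size_descent_tops_tuple //; last first.
      exact: subseq_uniq (descent_tops_subseq p) uniq_p.
    by rewrite (nth_map a) ?size_enum_ord // nth_ord_enum.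
  exists (composition_of p J); first by exists J => //; apply/(is_vhcP R sw_H JE).
  exact: color_compositionE sw_H JE vH.
have hook_ex (a : 'I_(ndes p)) : exists h : hook p,
    sw h = nth 0%N (descents p) a :> nat /\
    J (nth 0%N (descent_tops p) a) = tnth p (ne h).
  set u := nth 0%N (descent_tops p) a; have uD : u \in descent_tops p by apply/mem_descent_topsP; exists a.
  have [/tnthP[j Ju] lt above _] := HJ u uD.
  have [i ui] := tnthP _ _ (descent_tops_sub uD).
  have lt_ij : (i < j)%N by rewrite Ju ui !index_tnth in lt.
  have rises : (tnth p i < tnth p j)%N.
    rewrite -ui -Ju; apply: above; first exact: descent_tops_sub.
    by rewrite lt andbT.
  exists (Hook lt_ij rises); split; last exact: Ju.
  have -> : sw (Hook lt_ij rises) = index u p :> nat by rewrite ui index_tnth.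
  rewrite /u.
  have d_mem : nth 0%N (descents p) a \in descents p by rewrite mem_nth.
  rewrite descent_topsE size_tuple -/(descents p) (nth_map 0%N) // index_uniq //.
  by move: d_mem; rewrite mem_filter mem_iota size_tuple => /andP[_]; clear; lia.
have [H HE] := fin_all_exists hook_ex.
have sw_H a : sw (H a) = nth 0%N (descents p) a :> nat by case: (HE a).
have JE (a : 'I_(ndes p)) : J (nth 0%N (descent_tops p) a) = tnth p (ne (H a)).
  by case: (HE a).
have vH := (is_vhcP R sw_H JE).2 HJ.
exists H => //; apply/matrixP => i j; rewrite ord1 qE.
by rewrite (color_compositionE sw_H JE vH).
Qed.

End Points.

(** * The polyhedron *)

Lemma sumn_mask b q : sumn (mask b q) =
  \sum_(j < size q | nth false b j) nth 0 q j.
Proof.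
rewrite sumnE big_mask; apply: eq_big => [j|j _]; first by rewrite andbT.
by rewrite (tnth_nth 0).
Qed.

Lemma sumn_nth q : sumn q = \sum_(j < size q) nth 0 q j.
Proof. by rewrite sumnE (big_nth 0) big_mkord. Qed.

Local Open Scope classical_set_scope.
Local Open Scope ring_scope.

(** Nonnegativity is included so that integer points come from lists of natural numbers. *)
Definition polyhedron (R : realType) (m N : nat) (cs : seq (bitseq * nat)) :
    set 'rV[R]_m :=
  [set x | [/\ forall j, 0 <= x 0 j, \sum_j x 0 j = N%:R &
    forall c, c \in cs -> c.2%:R <= \sum_(j : 'I_m | nth false c.1 j) x 0 j]].

Lemma convex_polyhedron (R : realType) (m N : nat) cs :
  convex_set (@polyhedron R m N cs).
Proof.
move=> x y l; rewrite !inE => -[x0 xN xc] [y0 yN yc].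
have l0 : 0 <= l%:num by [].
have l1 : 0 <= 1 - l%:num by rewrite subr_ge0.
have convE j : (conv l x y : 'rV[R]_m) 0 j =
    l%:num * x 0 j + (1 - l%:num) * y 0 j by rewrite !mxE.
have sumE (P : pred 'I_m) : \sum_(j | P j) (conv l x y : 'rV[R]_m) 0 j =
    l%:num * \sum_(j | P j) x 0 j + (1 - l%:num) * \sum_(j | P j) y 0 j.
  by rewrite !mulr_sumr -big_split; apply: eq_bigr => j _; apply: convE.
split=> [j||c cC].
- by rewrite convE addr_ge0 ?mulr_ge0.
- by rewrite sumE xN yN -mulrDl addrC subrK mul1r.
- rewrite sumE (_ : c.2%:R = l%:num * c.2%:R + (1 - l%:num) * c.2%:R :> R).
    by rewrite lerD ?ler_wpM2l ?xc ?yc.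
  by rewrite -mulrDl addrC subrK mul1r.
Qed.

Lemma polyhedron_nat (R : realType) (m N : nat) cs (s : seq nat) (x : 'rV[R]_m) :
  size s = m -> (forall j : 'I_m, x 0 j = (nth 0%N s j)%:R) ->
  polyhedron N cs x <-> sumn s = N /\ satisfies cs s.
Proof.
move=> sz; case: m / sz x => x xE.
have sumE (P : pred 'I_(size s)) :
    \sum_(j | P j) x 0 j = (\sum_(j < size s | P j) nth 0 s j)%N%:R.
  by rewrite natr_sum; apply: eq_bigr => j _; apply: xE.
rewrite /polyhedron /= sumE -sumn_nth; split=> [[_ /eqP sN sc]|[<- /allP sc]].
  split; first by move: sN; rewrite eqr_nat => /eqP.
  by apply/allP => c /sc; rewrite sumE ler_nat -sumn_mask.
split=> // [j|c cC]; first by rewrite xE.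
by rewrite sumE ler_nat -sumn_mask; apply: sc.
Qed.

Lemma valid_compositions_polyhedron (R : realType) (n : nat) (p : n.-tuple nat) :
  uniq p -> exists cs, forall q : 'rV[int]_(ndes p).+1,
  valid_compositions R p q <-> polyhedron (n - ndes p) cs (int_embedding R q).
Proof.
move=> up; have [cs _ csP] := valid_composition_polyhedral up.
exists cs => q.
have le_ndes : (ndes p <= n)%N.
  rewrite -(size_descent_tops_tuple p) -[n in (_ <= n)%N](size_tuple p).
  exact: size_subseq (descent_tops_subseq p).
have validP s : valid_composition p s <->
    [/\ size s = (ndes p).+1, sumn s = (n - ndes p)%N & satisfies cs s].
  (* The whole word is taken with an empty tail. *)
  have := csP [::]; rewrite cats0 addn0 size_descent_tops_tuple size_tuple.
  move=> -> //; last by rewrite /tail_of allrel0r.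
  by split=> -[sz sum ?]; split=> //; clear -sum le_ndes; lia.
have embE s : (forall j, q 0 j = (nth 0%N s j)%:Z) ->
    forall j, int_embedding R q 0 j = (nth 0%N s j)%:R.
  by move=> qs j; rewrite mxE qs.
split=> [/(valid_compositionsP up)[s /validP[sz sN sc] qs]|qP].
  exact/(polyhedron_nat _ _ sz (embE s qs)).
pose s := [seq absz (q 0 j) | j <- enum 'I_(ndes p).+1].
have sz : size s = (ndes p).+1 by rewrite size_map size_enum_ord.
have qs j : q 0 j = (nth 0%N s j)%:Z.
  rewrite (nth_map j) ?size_enum_ord // nth_ord_enum gez0_abs //.
  by case: qP => /(_ j); rewrite mxE ler0z.
apply/(valid_compositionsP up); exists s => //; apply/validP.
by case/(polyhedron_nat _ _ sz (embE s qs)): qP.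
Qed.

Theorem theorem3p1 (R : realType) (n : nat) (p : n.-tuple nat)
    (n_gt0 : (0 < n)%N)
    (p_distinct : uniq p)
    (p_positive : forall i : 'I_n, (0 < tnth p i)%N) :
  int_embedding R @` valid_compositions R p =
  fertilitope R p `&` range (@int_embedding R (ndes p).+1).
Proof.
have [cs csP] := valid_compositions_polyhedron R p_distinct.
apply/seteqP; split=> [x [q vq <-]|x [hx [q _ qx]]].
  by split; [apply: sub_gen_smallest; exists q|exists q].
(* The polyhedron is convex and contains the valid compositions, hence their hull; its integer
   points are valid by [csP]. *)
exists q => //; apply/csP; rewrite qx.
apply: smallest_sub hx; first exact: convex_polyhedron.
by move=> _ [q' vq' <-]; apply/csP.
Qed.
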